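(* Let $X$ be a real normed space, let $C\subseteq X$ be a convex set, and let $h:C\rightarrow\mathbb{R}$ be a function. If $h$ is strongly quasiconvex with modulus $\gamma>0$ and $\overline{x}\in\operatorname{argmin}_{C}h$, then $$h(\overline{x})+\frac{\gamma}{4}\lVert y-\overline{x}\rVert^{2}\leq h(y)\quad\text{for all } y\in C.$$
   Context: A function $h:C\to\mathbb{R}$ on a convex subset $C$ of a normed space $X$ is called strongly quasiconvex with modulus $\gamma>0$ if for every $x,y\in C$ and every $t\in[0,1]$, $$h(x+t(y-x))\leq\max\{h(x),h(y)\}-\frac{\gamma}{2}t(1-t)\lVert y-x\rVert^{2}.$$ The notation $\overline{x}\in\operatorname{argmin}_{C}h$ means $\overline{x}\in C$ and $h(\overline{x})\leq h(y)$ for all $y\in C$. *)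

(* Defs.v *)
From HB Require Import structures.
From mathcomp Require Import all_boot all_order all_algebra.
From mathcomp Require Import all_classical all_reals all_analysis.

Set Implicit Arguments.
Unset Strict Implicit.
Unset Printing Implicit Defensive.

Import Order.TTheory GRing.Theory Num.Theory.
Import numFieldNormedType.Exports.

Local Open Scope classical_set_scope.
Local Open Scope ring_scope.

(* A function h : C -> R is represented by a total function h : X -> R whose
   values outside C play no role: on a convex C, the point x + t (y - x) below
   lies in C. *)
Definition strongly_quasiconvex (R : realType) (X : normedModType R)
    (C : set X) (h : X -> R) (gamma : R) : Prop :=
  forall x y : X, C x -> C y -> forall t : R, 0 <= t <= 1 ->
    h (x + t *: (y - x)) <=
      Num.max (h x) (h y) - gamma / 2 * t * (1 - t) * `|y - x| ^+ 2.

Definition argmin (R : realType) (X : normedModType R)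
    (C : set X) (h : X -> R) : set X :=
  [set x | C x /\ forall y : X, C y -> h x <= h y].

(* Main.v *)
Require Import Defs.
From HB Require Import structures.
From mathcomp Require Import all_boot all_order all_algebra.
From mathcomp Require Import all_classical all_reals all_analysis.
From mathcomp Require Import ring lra.
Import Order.TTheory GRing.Theory Num.Theory.
Import numFieldNormedType.Exports.
Local Open Scope classical_set_scope.
Local Open Scope ring_scope.

(** The midpoint [t = 1/2] of the segment from [xbar] to [y] gives at once
    [h xbar <= h y - gamma/8 * `|y - xbar|^2], which is half of the wanted
    constant: the estimate uses only [h xbar <= h (x_t)] at the intermediate
    point [x_t = xbar + t (y - xbar)], whereas [h (x_t)] itself already exceeds
    [h xbar] by a quadratic amount.  Feeding that gain back improves the constant.
    If [h] grows with constant [c] around [xbar], then for every [t] between 0 and 1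
    [[
      h xbar + c t^2 `|y - xbar|^2 <= h (x_t)
                                   <= h y - gamma/2 t (1 - t) `|y - xbar|^2,
    ]]
    so that [h] also grows with constant [t^2 c + gamma/2 t (1 - t)]
    ([quadratic_growth_improve]).  For a fixed [t < 1] the iterates tend to
    [gamma/2 t / (1 + t)], whose supremum [gamma/4] is approached as [t -> 1].
    Letting [t = (n+1)/(n+2)] vary with the step performs both limits together:
    starting from [0], the constants are exactly [gamma/4 (1 - 1/(n+1))]
    ([argmin_quadratic_growth_harmonic]), and growth passes to their limit. *)

Lemma convex_set_segment {R : realType} {X : normedModType R} {C : set X}
    (hC : convex_set C) (x y : X) (t : R) :
  C x -> C y -> 0 <= t <= 1 -> C (x + t *: (y - x)).
Proof.
move=> Cx Cy /andP[t0 t1].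
have /set_mem := hC y x (Itv01 t0 t1) (mem_set Cy) (mem_set Cx).
(* [conv] weights its first argument by [t]: it unfolds to [t *: y + (1 - t) *: x] *)
rewrite [conv _ _ _](_ : _ = t *: y + (1 - t) *: x)//.
by rewrite scalerBr scalerBl scale1r addrCA.
Qed.

Definition quadratic_growth {R : realType} {X : normedModType R}
    (C : set X) (h : X -> R) (x : X) (c : R) : Prop :=
  forall y : X, C y -> h x + c * `|y - x| ^+ 2 <= h y.

Lemma argmin_quadratic_growth0 {R : realType} {X : normedModType R}
    {C : set X} {h : X -> R} {x : X} :
  argmin C h x -> quadratic_growth C h x 0.
Proof. by move=> [_ hx] y Cy; rewrite mul0r addr0 hx. Qed.

Lemma quadratic_growth_cvg {R : realType} {X : normedModType R}
    {C : set X} {h : X -> R} {x : X} {u : nat -> R} {c : R} :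
  u @ \oo --> c -> (forall n, quadratic_growth C h x (u n)) ->
  quadratic_growth C h x c.
Proof.
move=> uc gu y Cy.
have lim_u : h x + u n * `|y - x| ^+ 2 @[n --> \oo] -->
    h x + c * `|y - x| ^+ 2.
  by apply: cvgD; [exact: cvg_cst | apply: cvgM => //; exact: cvg_cst].
by apply: (cvgr_to_le lim_u); apply: nearW => n; exact: gu.
Qed.

(** Evaluate [h] at [x + t (y - x)]: growth around [x] bounds this value from
    below, with distance [t `|y - x|] to [x], and strong quasiconvexity bounds it
    from above. *)
Lemma quadratic_growth_improve {R : realType} {X : normedModType R}
    {C : set X} {h : X -> R} {gamma : R} {x : X} {c t : R} :
  convex_set C -> strongly_quasiconvex C h gamma -> argmin C h x ->
  0 <= t <= 1 -> quadratic_growth C h x c ->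
  quadratic_growth C h x (t ^+ 2 * c + gamma / 2 * t * (1 - t)).
Proof.
move=> hC hh [Cx hx] t01 gc y Cy.
have lower := gc _ (convex_set_segment hC x y t Cx Cy t01).
have upper := hh x y Cx Cy t t01.
rewrite (max_idPr (hx y Cy)) in upper.
have {lower upper} := le_trans lower upper.
rewrite [x + _]addrC addrK normrZ exprMn real_normK ?num_real//.
lra.
Qed.

Lemma argmin_quadratic_growth_harmonic {R : realType} {X : normedModType R}
    {C : set X} {h : X -> R} {gamma : R} {x : X} (n : nat) :
  convex_set C -> strongly_quasiconvex C h gamma -> argmin C h x ->
  quadratic_growth C h x (gamma / 4 * (1 - harmonic n)).
Proof.
move=> hC hh hx; elim: n => [|n IHn].
  by rewrite /= invr1 subrr mulr0; exact: argmin_quadratic_growth0.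
have n0 : 0 <= n%:R :> R by exact: ler0n.
have t01 : 0 <= (n.+1%:R / n.+2%:R : R) <= 1.
  by rewrite divr_ge0//= ler_pdivrMr// mul1r ler_nat.
suff -> : gamma / 4 * (1 - harmonic n.+1) =
    (n.+1%:R / n.+2%:R) ^+ 2 * (gamma / 4 * (1 - harmonic n)) +
    gamma / 2 * (n.+1%:R / n.+2%:R) * (1 - n.+1%:R / n.+2%:R).
  exact: quadratic_growth_improve hC hh hx t01 IHn.
rewrite /= -[n.+2%:R]natr1 -[n.+1%:R]natr1.
by field; apply/andP; split; apply: lt0r_neq0; lra.
Qed.

Theorem corollary9 (R : realType) (X : normedModType R) (C : set X)
    (hC : convex_set C) (h : X -> R) (gamma : R) (hgamma : 0 < gamma)
    (hh : strongly_quasiconvex C h gamma) (xbar : X) (hxbar : argmin C h xbar) :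
  forall y : X, C y -> h xbar + gamma / 4 * `|y - xbar| ^+ 2 <= h y.
Proof.
have lim_c : gamma / 4 * (1 - harmonic n) @[n --> \oo] --> gamma / 4.
  have lim1 : 1 - harmonic n @[n --> \oo] --> (1 - 0 : R).
    by apply: cvgB; [exact: cvg_cst | exact: cvg_harmonic].
  rewrite subr0 in lim1.
  have := cvgM (cvg_cst (gamma / 4)) lim1.
  by rewrite mulr1; apply.
apply: (quadratic_growth_cvg lim_c) => n.
exact: argmin_quadratic_growth_harmonic.
Qed.
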